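(* Let a proper element $q\in L$ be $2$-potent $\delta$-primary. Then $q$ is $\phi$-$\delta$-primary for some function $\phi:L\to L$ with $\phi\leqslant\phi_2$ if and only if $q$ is $\delta$-primary.
   Context: A multiplicative lattice is a complete lattice (least element $0$, greatest element $1$) with a commutative, associative multiplication that distributes over arbitrary joins and for which $1$ is the identity. An element $a$ is compact if $a\leqslant \bigvee X$ with $X\subseteq L$ implies $a\leqslant a_1\vee\dots\vee a_n$ for finitely many $a_i\in X$; $L$ is compactly generated if every element is a join of compact elements. Standing assumptions: $L$ is a compactly generated multiplicative lattice in which $1$ is compact and every finite product of compact elements is compact; $\delta:L\to L$ is an expansion function, i.e. $a\leqslant\delta(a)$ for all $a$, and $a\leqslant b$ implies $\delta(a)\leqslant\delta(b)$. An element $p$ is proper if $p<1$. A proper element $p$ is $\delta$-primary if for all $a,b\in L$, $ab\leqslant p$ implies $a\leqslant p$ or $b\leqslant\delta(p)$; it is $2$-potent $\delta$-primary if for all $a,b\in L$, $ab\leqslant p^2$ implies $a\leqslant p$ or $b\leqslant\delta(p)$. For $\phi:L\to L$, a proper element $p$ is $\phi$-$\delta$-primary if for all $a,b\in L$, $ab\leqslant p$ and $ab\not\leqslant\phi(p)$ implies $a\leqslant p$ or $b\leqslant\delta(p)$. $\phi_2(a)=a^2$, and $\gamma_1\leqslant\gamma_2$ for functions $L\to L$ means $\gamma_1(a)\leqslant\gamma_2(a)$ for all $a\in L$. *)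

(* Defs.v *)
From HB Require Import structures.
From mathcomp Require Import all_boot all_order.
From mathcomp Require Import boolp classical_sets.

Set Implicit Arguments.
Unset Strict Implicit.
Unset Printing Implicit Defensive.

Import Order.TTheory.

Local Open Scope classical_set_scope.
Local Open Scope order_scope.

Reserved Notation "x ** y" (at level 40, left associativity).

(* The least and greatest elements 0 and 1 are \bot and \top; completeness is
   given by a join operation [lsup] on arbitrary sets of elements. *)
HB.mixin Record isMultiplicativeLattice (d : Order.disp_t) L
    of Order.TBLattice d L := {
  lsup : set L -> L;
  lmul : L -> L -> L;
  lsupP : forall X : set L, supremums X (lsup X);
  lmulA : associative lmul;
  lmulC : commutative lmul;
  lmul1x : left_id (\top : L) lmul;
  lmul_supr : forall (a : L) (X : set L),
    lmul a (lsup X) = lsup [set lmul a x | x in X]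
}.

#[short(type="multLatticeType")]
HB.structure Definition MultLattice (d : Order.disp_t) :=
  { L of isMultiplicativeLattice d L & Order.TBLattice d L }.

Notation "x ** y" := (lmul x y) : order_scope.

Section Definitions.
Context {d : Order.disp_t} {L : multLatticeType d}.
Implicit Types (a b p : L) (delta phi : L -> L).

Definition lexp a (n : nat) : L := iterop n lmul a (\top : L).

Definition compact_elt a : Prop :=
  forall X : set L, a <= lsup X ->
    exists s : seq L, [set` s] `<=` X /\ a <= \join_(x <- s) x.

Definition compactly_generated : Prop :=
  forall a, exists X : set L, X `<=` compact_elt /\ a = lsup X.

Definition compact_mul_closed : Prop :=
  forall s : seq L, [set` s] `<=` compact_elt ->
    compact_elt (\big[lmul/(\top : L)]_(x <- s) x).

Definition expansion delta : Prop :=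
  (forall a, a <= delta a) /\ {homo delta : a b / a <= b}.

Definition proper_elt p : Prop := p < \top.

Definition delta_primary delta p : Prop :=
  proper_elt p /\
  forall a b, a ** b <= p -> a <= p \/ b <= delta p.

Definition two_potent_delta_primary delta p : Prop :=
  proper_elt p /\
  forall a b, a ** b <= lexp p 2 -> a <= p \/ b <= delta p.

Definition phi_delta_primary phi delta p : Prop :=
  proper_elt p /\
  forall a b, a ** b <= p -> ~ (a ** b <= phi p) -> a <= p \/ b <= delta p.

Definition phi2 a : L := lexp a 2.

End Definitions.

Arguments compactly_generated {d} L.
Arguments compact_mul_closed {d} L.

(* Main.v *)
Require Import Defs.
From mathcomp Require Import all_boot all_order.
From mathcomp Require Import boolp classical_sets.

Import Order.TTheory.

Local Open Scope order_scope.

(** A product [a ** b <= q] falls into one of two cases. Outside [phi q] it is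
    covered by [phi]-[delta]-primariness; inside [phi q] it lies below
    [phi2 q], the square of [q], where 2-potent [delta]-primariness applies to
    the same pair [a], [b]. Conversely a [delta]-primary element satisfies the
    [phi]-[delta]-primary condition for every [phi], so [phi2] itself is a
    witness. *)

Theorem theorem2p23 (d : Order.disp_t) (L : multLatticeType d)
    (Lcg : compactly_generated L)
    (compact1 : compact_elt (\top : L))
    (compactM : compact_mul_closed L)
    (delta : L -> L) (delta_exp : expansion delta)
    (q : L) (q_proper : proper_elt q)
    (q_2potent : two_potent_delta_primary delta q) :
  (exists phi : L -> L, phi <= phi2 /\ phi_delta_primary phi delta q) <->
  delta_primary delta q.
Proof.
split=> [[phi [/lefP phi_le [_ q_phi]]]|[_ q_prim]].
  split=> // a b ab_q; have [ab_phi|/negP] := boolP (a ** b <= phi q).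
    exact: (proj2 q_2potent a b (le_trans ab_phi (phi_le q))).
  exact: q_phi.
by exists phi2; split; [exact: lexx | split=> // a b /q_prim].
Qed.
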